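(* Let $\emptyset\ne A\subseteq\widetilde{\mathbb R}^d$. Let $u=[(u_\varepsilon)_\varepsilon]\in\widetilde{\mathcal G}(A)$. (1) For $\tilde x=[(x_\varepsilon)_\varepsilon]\in A$, $u(\tilde x)=[(u_\varepsilon(x_\varepsilon))_\varepsilon]\in\widetilde{\mathbb C}$ is well-defined (independent of the representatives of $u$ and of $\tilde x$). (2) If $\tilde x$ belongs to the interior of $A$ (for the sharp topology) and $u(\tilde y)=0$ for each $\tilde y$ in a sharp neighbourhood of $\tilde x$, then $\partial^\alpha u(\tilde x)=0$ for all $\alpha\in\mathbb N^d$. (3) If $A$ is open (for the sharp topology), then $u=0$ in $\widetilde{\mathcal G}(A)$ if and only if $u(\tilde x)=0$ for all $\tilde x\in A$.
   Context: Nets are indexed by $\varepsilon\in(0,1)$; ''for small $\varepsilon$'' means for all $\varepsilon\le\varepsilon_0$ for some $\varepsilon_0\in(0,1)$; $0\in\mathbb N$. For $E=\mathbb C$ or $E=\mathbb R^d$, a net $(x_\varepsilon)_\varepsilon$ in $E$ is moderate ($\in\mathcal M_E$) if there is $N\in\mathbb N$ with $|x_\varepsilon|\le\varepsilon^{-N}$ for small $\varepsilon$, and negligible ($\in\mathcal N_E$) if for each $m\in\mathbb N$, $|x_\varepsilon|\le\varepsilon^m$ for small $\varepsilon$. $\widetilde{\mathbb C}=\mathcal M_{\mathbb C}/\mathcal N_{\mathbb C}$, $\widetilde{\mathbb R}^d=\mathcal M_{\mathbb R^d}/\mathcal N_{\mathbb R^d}$; $[(x_\varepsilon)_\varepsilon]$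 is the class of $(x_\varepsilon)_\varepsilon$. Sharp norm: for $\tilde x=[(x_\varepsilon)_\varepsilon]$, $\mathrm v(\tilde x)=\sup\{b\in\mathbb R:|x_\varepsilon|\le\varepsilon^b\text{ for small }\varepsilon\}$ and $|\tilde x|_{\mathrm e}=e^{-\mathrm v(\tilde x)}$. The sharp topology on $\widetilde{\mathbb R}^d$ is the topology of the ultrametric $|\tilde x_1-\tilde x_2|_{\mathrm e}$. $\widetilde{\mathcal G}(A)=\mathcal E_M(A)/\mathcal N(A)$, where $\mathcal E_M(A)$ (resp. $\mathcal N(A)$) is the set of nets $(u_\varepsilon)_\varepsilon$ of $C^\infty$ functions $\mathbb R^d\to\mathbb C$ such that for every $\alpha\in\mathbb N^d$ and every representative $(x_\varepsilon)_\varepsilon$ of every element of $A$, $(\partial^\alpha u_\varepsilon(x_\varepsilon))_\varepsilon\in\mathcal M_{\mathbb C}$ (resp. $\in\mathcal N_{\mathbb C}$). All operations (including derivatives $\partial^\alpha u=[(\partial^\alpha u_\varepsilon)_\varepsilon]$) are $\varepsilon$-wise. *)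

(* Defs.v *)
From HB Require Import structures.
From mathcomp Require Import all_boot all_order all_algebra.
From mathcomp Require Import ring lra.
From mathcomp Require Import generic_quotient ring_quotient.
From mathcomp Require Import complex.
From mathcomp Require Import all_classical all_reals all_analysis.

Set Implicit Arguments.
Unset Strict Implicit.
Unset Printing Implicit Defensive.

Import Order.TTheory GRing.Theory Num.Theory.
Import numFieldNormedType.Exports.

Local Open Scope classical_set_scope.
Local Open Scope ring_scope.
Local Open Scope quotient_scope.

Section Nets.
Variable R : realType.

Definition eps := {e : R | 0 < e < 1}.

Definition for_small : set_system eps :=
  [set P | exists e0 : eps, forall e : eps, val e <= val e0 -> P e].

Lemma eps_gt0 (e : eps) : 0 < val e. Proof. by case/andP: (valP e). Qed.
Lemma eps_lt1 (e : eps) : val e < 1. Proof. by case/andP: (valP e). Qed.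

Lemma eps_below (r : R) : 0 < r -> exists e : eps, val e <= r.
Proof.
move=> r0.
have h : 0 < Num.min r (2^-1 : R) < 1.
  by rewrite lt_min r0 invr_gt0 ltr0n/= gt_min [X in _ || X]invf_lt1 ?ltr1n// orbT.
by exists (exist (fun x : R => 0 < x < 1) _ h); rewrite /= ge_min lexx.
Qed.

Global Instance for_small_filter : ProperFilter for_small.
Proof.
split; first by case=> e0 /(_ e0 (lexx _)).
split.
- by have [e _] := eps_below (@ltr01 R); exists e.
- move=> P Q [p hp] [q hq].
  have [r hr] : exists r : eps, val r <= Num.min (val p) (val q).
    by apply: eps_below; rewrite lt_min !eps_gt0.
  move: hr; rewrite le_min => /andP[rp rq].
  by exists r => e he; split; [apply: hp|apply: hq]; apply: le_trans he _.
- by move=> P Q PQ [p hp]; exists p => e /hp /PQ.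
Qed.

Lemma for_small_le (r : R) : 0 < r -> for_small (fun e => val e <= r).
Proof. by move=> /eps_below[e he]; exists e => e' h; exact: le_trans h he. Qed.

Lemma for_smallS (P Q : eps -> Prop) :
  (forall e, P e -> Q e) -> for_small P -> for_small Q.
Proof. exact: filterS. Qed.

Lemma for_smallS2 (P Q S : eps -> Prop) :
  (forall e, P e -> Q e -> S e) -> for_small P -> for_small Q -> for_small S.
Proof. exact: filterS2. Qed.

Section Quotient.
Variable E : normedZmodType R.

Definition moderate : {pred eps -> E} := fun x =>
  `[< exists N : nat, for_small (fun e => `|x e| <= (val e) ^- N) >].

Lemma moderateP x : reflect
  (exists N : nat, for_small (fun e => `|x e| <= (val e) ^- N)) (x \in moderate).
Proof. exact: asboolP. Qed.

Lemma expV_mono (e : eps) (m n : nat) : (m <= n)%N -> val e ^- m <= val e ^- n.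
Proof.
move=> mn; rewrite lef_pV2 ?posrE ?exprn_gt0 ?eps_gt0//.
by apply: ler_wiXn2l => //; rewrite ltW ?eps_gt0 ?eps_lt1.
Qed.

Lemma moderate_zmod : zmod_closed moderate.
Proof.
split.
  apply/moderateP; exists 0%N; have [e _] := eps_below (@ltr01 R).
  by exists e => e' _; rewrite normr0 expr0 invr1.
move=> x y /moderateP[m hm] /moderateP[n hn]; apply/moderateP.
exists (maxn m n).+1.
have h := for_small_le (r := 2^-1) _.
apply: for_smallS2 hm (filterI hn (h _)); last by rewrite invr_gt0.
move=> e xm [yn e2] /=.
have e0 := eps_gt0 e.
apply: (le_trans (ler_normB _ _)).
apply: (@le_trans _ _ (2 * val e ^- maxn m n)).
  rewrite mulr_natl mulr2n; apply: lerD.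
    by apply: (le_trans xm); apply: expV_mono; exact: leq_maxl.
  by apply: (le_trans yn); apply: expV_mono; exact: leq_maxr.
rewrite exprS invfM ler_pM2r ?invr_gt0 ?exprn_gt0//.
by rewrite -[leLHS]invrK lef_pV2 ?posrE ?invr_gt0.
Qed.

HB.instance Definition _ := GRing.isZmodClosed.Build (eps -> E) moderate moderate_zmod.

Definition mnet := {x : eps -> E | x \in moderate}.
Definition Mnet (x : eps -> E) (hx : x \in moderate) : mnet :=
  exist (fun x => x \in moderate) x hx.
HB.instance Definition _ := Choice.on mnet.
HB.instance Definition _ := SubChoice.on mnet.
HB.instance Definition _ := [SubChoice_isSubZmodule of mnet by <:].

Definition negligible_net (x : eps -> E) :=
  forall m : nat, for_small (fun e => `|x e| <= (val e) ^+ m).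

Definition null_net : {pred mnet} := fun x => `[< negligible_net (val x) >].

Lemma null_netP x : reflect (negligible_net (val x)) (x \in null_net).
Proof. exact: asboolP. Qed.

Lemma null_net_zmod : zmod_closed null_net.
Proof.
split.
  apply/null_netP => m; have [e _] := eps_below (@ltr01 R).
  by exists e => e' _; rewrite normr0 exprn_ge0// ltW ?eps_gt0.
move=> x y /null_netP hx /null_netP hy; apply/null_netP => m.
have h := for_small_le (r := 2^-1) _.
apply: for_smallS2 (hx m.+1) (filterI (hy m.+1) (h _)); last by rewrite invr_gt0.
move=> e xm [ym e2] /=.
have e0 := eps_gt0 e.
apply: (le_trans (ler_normB _ _)).
apply: (le_trans (lerD xm ym)).
rewrite -mulr2n -mulr_natl exprS mulrA ler_piMl ?exprn_ge0 ?(ltW e0)//.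
have : val e <= 2^-1 by [].
lra.
Qed.

HB.instance Definition _ := GRing.isZmodClosed.Build mnet null_net null_net_zmod.

(* For E = C and E = R^d this is \tilde C and \tilde R^d. *)
Definition gpt := Quotient.quot null_net.
HB.instance Definition _ := GRing.Zmodule.on gpt.
HB.instance Definition _ := EqQuotient.on gpt.

End Quotient.
End Nets.
Arguments moderate {R} E.
Arguments null_net {R} E.

Section Sharp.
Variables (R : realType) (E : normedZmodType R).

Lemma gptP (x y : mnet E) :
  \pi_(gpt E) x = \pi_(gpt E) y <-> negligible_net (fun e => val x e - val y e).
Proof.
split=> [/eqP|h]; last apply/eqP.
  by rewrite -Quotient.idealrBE => /null_netP.
by rewrite -Quotient.idealrBE; apply/null_netP.
Qed.

Definition vnet (x : eps R -> E) : \bar R :=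
  ereal_sup [set b%:E | b in [set b : R | for_small (fun e => `|x e| <= val e `^ b)]].

(* The valuation of any representative: see sharp_val_pi. *)
Definition sharp_val (x : gpt E) : \bar R := vnet (val (repr x)).

(* sharp_val x > -oo by moderateness, so that fine is harmless: see sharp_normE. *)
Definition sharp_norm (x : gpt E) : R := fine (expeR (- sharp_val x)).

Lemma powR_eps_mono (e : eps R) (a b : R) : a <= b -> val e `^ b <= val e `^ a.
Proof. by move=> ab; apply: ger_powR => //; rewrite ?eps_gt0 ?ltW ?eps_lt1. Qed.

Lemma vnet_lt (x : eps R -> E) (b : R) : (b%:E < vnet x)%E ->
  for_small (fun e => `|x e| <= val e `^ b).
Proof.
move=> /ereal_sup_gt[_ [c hc <-]]; rewrite lte_fin => bc.
apply: for_smallS hc => e /le_trans; apply; exact/powR_eps_mono/ltW.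
Qed.

Lemma vnet_ge (x : eps R -> E) (b : R) :
  for_small (fun e => `|x e| <= val e `^ b) -> (b%:E <= vnet x)%E.
Proof. by move=> h; apply: ereal_sup_ubound; exists b. Qed.

Lemma vnetN (x : eps R -> E) : vnet (- x) = vnet x.
Proof.
rewrite /vnet; congr ereal_sup; apply/seteqP.
by split=> _ [b hb <-]; exists b => //; apply: for_smallS hb => e /=; rewrite normrN.
Qed.

Lemma lt_ereal_le (a b : \bar R) :
  (forall r : R, (r%:E < a)%E -> (r%:E <= b)%E) -> (a <= b)%E.
Proof.
move=> h; rewrite leNgt; apply/negP.
move: a b h => [a| |] [b| |] //= h.
- rewrite lte_fin => ba; have := h ((a + b) / 2).
  rewrite lte_fin lee_fin; lra.
- by move=> _; have /= := h (a - 1); rewrite lte_fin leeNy_eq /= => hh; have : false by apply: hh; lra.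
- by move=> _; have := h (b + 1); rewrite ltry lee_fin => /(_ isT); lra.
- by move=> _; have := h 0; rewrite ltry => /(_ isT).
Qed.

Lemma vnetD (x y : eps R -> E) : (Order.min (vnet x) (vnet y) <= vnet (x + y)%R)%E.
Proof.
apply: lt_ereal_le => r rm.
have [s rs sm] : exists2 s : R, r < s & (s%:E < Order.min (vnet x) (vnet y))%E.
  move: rm; case: (Order.min _ _) => [a| |] //.
    by rewrite lte_fin => ra; exists ((r + a) / 2); rewrite ?lte_fin; lra.
  by move=> _; exists (r + 1); rewrite ?ltry ?ltrDl.
move: sm; rewrite lt_min => /andP[/vnet_lt hx /vnet_lt hy].
apply: vnet_ge.
have sr : 0 < s - r by lra.
have p0 : 0 < 2^-1 `^ (s - r)^-1 :> R by rewrite powR_gt0// invr_gt0.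
apply: for_smallS2 hx (filterI hy (for_small_le p0)) => e xe [ye ee].
apply: (le_trans (ler_normD _ _)); apply: (le_trans (lerD xe ye)).
have -> : s = r + (s - r) by ring.
rewrite powRD; last by apply/implyP => _; rewrite gt_eqF ?eps_gt0.
have h : val e `^ (s - r) <= 2^-1.
  have -> : 2^-1 = (2^-1 `^ (s - r)^-1) `^ (s - r) :> R.
    by rewrite -powRrM mulVf ?gt_eqF// powRr1// invr_ge0.
  by apply: ge0_ler_powR; rewrite ?nnegrE ?powR_ge0 ?(ltW sr) ?(ltW (eps_gt0 _)).
rewrite -mulrDr -[leRHS]mulr1; apply: ler_wpM2l; first exact: powR_ge0.
lra.
Qed.


Lemma vnet_eqy (x : eps R -> E) : vnet x = +oo%E <-> negligible_net x.
Proof.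
split=> [xy m|h].
  have : for_small (fun e => `|x e| <= val e `^ m%:R) by apply: vnet_lt; rewrite xy ltry.
  by apply: for_smallS => e; rewrite powR_mulrn ?(ltW (eps_gt0 _)).
apply/eqP; rewrite -leye_eq; apply: lt_ereal_le => r _.
apply: vnet_ge; apply: for_smallS (h (Num.bound `|r|)) => e /le_trans; apply.
rewrite -powR_mulrn ?(ltW (eps_gt0 _))//; apply: powR_eps_mono.
by apply: (le_trans (ler_norm _)); apply/ltW/archi_boundP.
Qed.

Lemma vnet_gtNy (x : mnet E) : (-oo < vnet (val x))%E.
Proof.
have /moderateP[N h] := valP x.
apply: (@lt_le_trans _ _ (- N%:R)%:E); first exact: ltNyr.
apply: vnet_ge; apply: for_smallS h => e.
by rewrite powR_invn ?(ltW (eps_gt0 _)).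
Qed.

Lemma sharp_val_pi (x : mnet E) : sharp_val (\pi_(gpt E) x) = vnet (val x).
Proof.
have /gptP h : \pi_(gpt E) (repr (\pi_(gpt E) x)) = \pi_(gpt E) x by rewrite reprK.
set y := repr _ in h *; rewrite /sharp_val -/y.
have hz : vnet (\val y - \val x) = +oo%E by apply/vnet_eqy.
have hz' : vnet (\val x - \val y) = +oo%E by rewrite -vnetN opprB.
apply/eqP; rewrite eq_le; apply/andP; split.
- have := vnetD (\val x - \val y) (\val y).
  by rewrite subrK hz' min_r // leey.
- have := vnetD (\val y - \val x) (\val x).
  by rewrite subrK hz min_r // leey.
Qed.

Lemma gpt_ind (P : gpt E -> Prop) : (forall x, P (\pi_(gpt E) x)) -> forall x, P x.
Proof. by move=> h x; rewrite -[x]reprK. Qed.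

Lemma gpt0 : 0 = \pi_(gpt E) 0. Proof. by rewrite raddf0. Qed.

Lemma sharp_val0 : sharp_val 0 = +oo%E.
Proof.
rewrite gpt0 sharp_val_pi; apply/vnet_eqy => m.
by apply: filterE => e; rewrite normr0 exprn_ge0// ltW ?eps_gt0.
Qed.

Lemma sharp_val_eqy (x : gpt E) : sharp_val x = +oo%E -> x = 0.
Proof.
elim/gpt_ind: x => x; rewrite sharp_val_pi => /vnet_eqy h.
rewrite gpt0; apply/gptP => m; apply: for_smallS (h m) => e.
by rewrite subr0.
Qed.

Lemma sharp_valN (x : gpt E) : sharp_val (- x) = sharp_val x.
Proof. by elim/gpt_ind: x => x; rewrite -raddfN !sharp_val_pi vnetN. Qed.

Lemma sharp_valD (x y : gpt E) :
  (Order.min (sharp_val x) (sharp_val y) <= sharp_val (x + y)%R)%E.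
Proof.
elim/gpt_ind: x => x; elim/gpt_ind: y => y.
by rewrite -raddfD !sharp_val_pi vnetD.
Qed.

Lemma sharp_val_gtNy (x : gpt E) : (-oo < sharp_val x)%E.
Proof. exact: vnet_gtNy. Qed.

Lemma sharp_normE (x : gpt E) : (sharp_norm x)%:E = expeR (- sharp_val x)%E.
Proof.
have := sharp_val_gtNy x; rewrite /sharp_norm.
by case: (sharp_val x).
Qed.

Lemma sharp_norm0 : sharp_norm 0 = 0.
Proof. by rewrite /sharp_norm sharp_val0. Qed.

Lemma sharp_norm_eq0 (x : gpt E) : sharp_norm x = 0 -> x = 0.
Proof.
move=> h; apply: sharp_val_eqy; have := sharp_normE x; rewrite h.
have := sharp_val_gtNy x; case: (sharp_val x) => [r||]//= _ [] /esym/eqP.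
by rewrite gt_eqF ?expR_gt0.
Qed.

Lemma sharp_normN (x : gpt E) : sharp_norm (- x) = sharp_norm x.
Proof. by rewrite /sharp_norm sharp_valN. Qed.

Lemma sharp_normD_max (x y : gpt E) :
  sharp_norm (x + y) <= Num.max (sharp_norm x) (sharp_norm y).
Proof.
have := sharp_valD x y; rewrite ge_min le_max => /orP h; apply/orP.
by case: h => h; [left|right]; rewrite -lee_fin !sharp_normE lee_expeR leeN2.
Qed.

Lemma sharp_norm_ge0 (x : gpt E) : 0 <= sharp_norm x.
Proof. by rewrite -lee_fin sharp_normE expeR_ge0. Qed.

Lemma sharp_normD (x y : gpt E) : sharp_norm (x + y) <= sharp_norm x + sharp_norm y.
Proof.
apply: (le_trans (sharp_normD_max x y)).
by rewrite ge_max lerDl lerDr !sharp_norm_ge0.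
Qed.

(* This ultrametric (see sharp_normD_max) is the one that endows gpt E with the
   sharp topology, through the metricType instance below. *)
Definition sharp_dist (x y : gpt E) : R := sharp_norm (x - y).

Lemma sharp_distxx x : sharp_dist x x = 0.
Proof. by rewrite /sharp_dist subrr sharp_norm0. Qed.

Lemma sharp_dist_positivity x y : sharp_dist x y = 0 -> x = y.
Proof. by move=> /sharp_norm_eq0/eqP; rewrite subr_eq0 => /eqP. Qed.

Lemma sharp_dist_sym x y : sharp_dist x y = sharp_dist y x.
Proof. by rewrite /sharp_dist -opprB sharp_normN. Qed.

Lemma sharp_dist_triangle y x z : sharp_dist x z <= sharp_dist x y + sharp_dist y z.
Proof.
rewrite /sharp_dist; have -> : x - z = (x - y) + (y - z) by rewrite addrA subrK.
exact: sharp_normD.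
Qed.

HB.instance Definition _ := @isMetric.Build R (gpt E) sharp_dist
  sharp_distxx sharp_dist_positivity sharp_dist_sym sharp_dist_triangle.

Lemma sharp_ballE (x : gpt E) (r : R) : ball x r = [set y | sharp_dist x y < r].
Proof. by []. Qed.

Lemma sharp_openP (A : set (gpt E)) : open A <->
  forall x, A x -> exists2 r : R, 0 < r & forall y, sharp_dist x y < r -> A y.
Proof.
rewrite openE; split=> h x /h; rewrite /interior.
  by move=> /nbhs_ballP[r r0 hr]; exists r.
by move=> [r r0 hr]; apply/nbhs_ballP; exists r.
Qed.

End Sharp.

Section Euclidean.
Variable R : realType.

(* An alias of 'rV[R]_d, whose library norm is the maximum norm, carrying the
   Euclidean norm. *)
Definition euclid (d : nat) := 'rV[R]_d.
Variable d : nat.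

HB.instance Definition _ := GRing.Zmodule.on (euclid d).

Definition enorm (x : euclid d) : R := Num.sqrt (\sum_(i < d) x ord0 i ^+ 2).

Lemma sumsq_ge0 (x : euclid d) : 0 <= \sum_(i < d) x ord0 i ^+ 2.
Proof. by apply: sumr_ge0 => i _; exact: sqr_ge0. Qed.

Lemma enorm_ge0 x : 0 <= enorm x. Proof. exact: sqrtr_ge0. Qed.

Lemma enorm_cs (x y : euclid d) :
  \sum_(i < d) x ord0 i * y ord0 i <= enorm x * enorm y.
Proof.
set A := \sum_(i < d) x ord0 i ^+ 2; set B := \sum_(i < d) y ord0 i ^+ 2.
set P := \sum_(i < d) _ * _.
have A0 : 0 <= A by exact: sumsq_ge0.
rewrite -sqrtrM// -/A -/B; apply: (le_trans (ler_norm _)); rewrite -sqrtr_sqr ler_wsqrtr//.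
have : 0 <= \sum_(i < d) (A * y ord0 i - P * x ord0 i) ^+ 2.
  by apply: sumr_ge0 => i _; exact: sqr_ge0.
have -> : \sum_(i < d) (A * y ord0 i - P * x ord0 i) ^+ 2 = A * (A * B - P ^+ 2).
  rewrite (eq_bigr (fun i => A ^+ 2 * (y ord0 i ^+ 2) +
     (- (2 * A * P)) * (x ord0 i * y ord0 i) + P ^+ 2 * x ord0 i ^+ 2)); last first.
    by move=> i _; ring.
  rewrite !big_split /= -!mulr_sumr -/A -/B -/P; ring.
have [A00|Ap] := leP A 0.
  have {}A00 : A = 0 by apply/eqP; rewrite eq_le A00.
  move=> _; have /eqP := A00; rewrite psumr_eq0 => [/allP h|i _]; last exact: sqr_ge0.
  rewrite /P big1 ?expr0n ?mulr_ge0 ?sumsq_ge0// => i _.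
  by have := h i; rewrite mem_index_enum sqrf_eq0 => /(_ isT)/eqP->; rewrite mul0r.
by rewrite pmulr_rge0// subr_ge0.
Qed.

Lemma enormD x y : enorm (x + y) <= enorm x + enorm y.
Proof.
rewrite -(@ler_pXn2r _ 2) ?nnegrE ?addr_ge0 ?enorm_ge0//.
rewrite [leRHS]sqrrD /enorm !sqr_sqrtr ?sumsq_ge0//.
rewrite (eq_bigr (fun i => x ord0 i ^+ 2 + (x ord0 i * y ord0 i) *+ 2 + y ord0 i ^+ 2)); last first.
  by move=> i _; rewrite mxE sqrrD.
rewrite !big_split /= -[X in _ + X + _]mulr2n lerD2r lerD2l lerMn2r /=.
exact: enorm_cs.
Qed.

Lemma enorm_eq0 x : enorm x = 0 -> x = 0.
Proof.
move=> /eqP; rewrite sqrtr_eq0 => h; apply/rowP => i; rewrite mxE.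
have : \sum_(i < d) x ord0 i ^+ 2 == 0 by rewrite eq_le h sumsq_ge0.
rewrite psumr_eq0 => [/allP/(_ i)|j _]; last exact: sqr_ge0.
by rewrite mem_index_enum sqrf_eq0 => /(_ isT)/eqP.
Qed.

Lemma enormMn x n : enorm (x *+ n) = enorm x *+ n.
Proof.
rewrite /enorm (eq_bigr (fun i => (n%:R) ^+ 2 * x ord0 i ^+ 2)) => [|i _].
  rewrite -mulr_sumr sqrtrM ?sqr_ge0// sqrtr_sqr ger0_norm ?ler0n//.
  by rewrite mulr_natl.
have -> : (x *+ n) ord0 i = x ord0 i *+ n by exact: mulmxnE.
by rewrite -(mulr_natl (x ord0 i) n) exprMn.
Qed.

Lemma enormN x : enorm (- x) = enorm x.
Proof. by rewrite /enorm; congr Num.sqrt; apply: eq_bigr => i _; rewrite mxE sqrrN. Qed.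

HB.instance Definition _ := Num.Zmodule_isNormed.Build R (euclid d)
  enormD enorm_eq0 enormMn enormN.

End Euclidean.

Notation Rtilde R d := (gpt (euclid R d)).
Notation Ctilde R := (gpt (Rcomplex R)).

Section RealSmooth.
Variables (R : realType) (d : nat).
Implicit Types (f g : 'rV[R]_d -> R) (i j : 'I_d).

(* The partial derivatives are 'D_(e_i) f; C^k means that all the iterated
   partial derivatives of order at most k exist and are continuous. *)
Definition rpartial i f : 'rV[R]_d -> R := fun x => 'D_(delta_mx ord0 i) f x.

Fixpoint Ck k f : Prop := continuous f /\
  if k is k'.+1 then
    forall i, (forall x, derivable f x (delta_mx ord0 i)) /\ Ck k' (rpartial i f)
  else True.

Definition rsmooth f := forall k, Ck k f.

Lemma rsmooth_continuous f : rsmooth f -> continuous f.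
Proof. by move=> /(_ 0%N)[]. Qed.

Lemma rsmooth_derivable f : rsmooth f -> forall i x, derivable f x (delta_mx ord0 i).
Proof. by move=> /(_ 1%N)[_ h] i; case: (h i). Qed.

Lemma rsmooth_partial f i : rsmooth f -> rsmooth (rpartial i f).
Proof. by move=> h k; case: (h k.+1) => _ /(_ i)[]. Qed.

Lemma rpartial_cst c i : rpartial i (cst c) = cst 0.
Proof. by apply/funext => x; rewrite /rpartial derive_cst. Qed.

Lemma rsmooth_cst c : rsmooth (cst c).
Proof.
move=> k; elim: k c => [|k IH] c /=; split => //; try exact: cst_continuous.
by move=> i; split; [move=> x; exact: derivable_cst|rewrite rpartial_cst].
Qed.

Lemma rpartialB f g i : rsmooth f -> rsmooth g ->
  rpartial i (f - g) = rpartial i f - rpartial i g.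
Proof.
move=> hf hg; apply/funext => x; rewrite /rpartial deriveB //; exact: rsmooth_derivable.
Qed.

Lemma rsmoothB f g : rsmooth f -> rsmooth g -> rsmooth (f - g).
Proof.
move=> hf hg k; elim: k f g hf hg => [|k IH] f g hf hg /=; split => //.
- by move=> x; apply: continuousB; exact: rsmooth_continuous.
- by move=> x; apply: continuousB; exact: rsmooth_continuous.
- move=> i; split; first by move=> x; apply: derivableB; exact: rsmooth_derivable.
  by rewrite rpartialB//; apply: IH; exact: rsmooth_partial.
Qed.

Lemma derive_line f (v : 'rV[R]_d) x (t : R) : derivable f (x + t *: v) v ->
  is_derive t 1 (fun s : R => f (x + s *: v)) ('D_v f (x + t *: v)).
Proof.
move=> df.
have e : (fun h : R => h^-1 *: (((fun s : R => f (x + s *: v)) \o shift t) (h *: 1)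
            - f (x + t *: v))) =
         (fun h : R => h^-1 *: ((f \o shift (x + t *: v)) (h *: v) - f (x + t *: v))).
  apply/funext => h /=; congr (_ *: (f _ - _)).
  by rewrite scaler1 scalerDl addrCA.
by split; rewrite /derivable /derive e.
Qed.

Lemma mvt_line f (v : 'rV[R]_d) x (h : R) : (forall y, derivable f y v) -> 0 < h ->
  exists2 c, 0 <= c <= h & f (x + h *: v) - f x = 'D_v f (x + c *: v) * h.
Proof.
move=> df h0.
have dl (t : R) := derive_line (df (x + t *: v)).
have [|c] := @MVT R (fun s => f (x + s *: v)) (fun s => 'D_v f (x + s *: v)) 0 h h0
  (fun t _ => dl t).
  apply: continuous_subspaceT => t; apply: differentiable_continuous.
  by apply/derivable1_diffP; have [] := dl t.
rewrite in_itv/= => /andP[c0 ch]; rewrite scale0r addr0 subr0 => e.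
by exists c; rewrite // !ltW.
Qed.

Lemma second_diff f (a b x : 'rV[R]_d) (h : R) :
  (forall y, derivable f y a) -> (forall y, derivable ('D_a f) y b) -> 0 < h ->
  exists s t, [/\ 0 <= s <= h, 0 <= t <= h &
    f (x + h *: a + h *: b) - f (x + h *: a) - f (x + h *: b) + f x =
    'D_b ('D_a f) (x + s *: a + t *: b) * h ^+ 2].
Proof.
move=> da db h0.
pose g y := f (y + h *: b) - f y.
have dsh y : is_derive y a (fun y => f (y + h *: b)) ('D_a f (y + h *: b)).
  have e : (fun k : R => k^-1 *: (((fun y => f (y + h *: b)) \o shift y) (k *: a)
             - f (y + h *: b))) =
           (fun k : R => k^-1 *: ((f \o shift (y + h *: b)) (k *: a) - f (y + h *: b))).
    by apply/funext => k /=; rewrite addrA.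
  by split; rewrite /derivable /derive e //; exact: da.
have dg y : is_derive y a g ('D_a f (y + h *: b) - 'D_a f y).
  by have := da y => /derivableP dfy; apply: is_deriveB.
have [s sh es] := @mvt_line g a x h (fun y => let: DeriveDef p _ := dg y in p) h0.
have [t th et] := @mvt_line ('D_a f) b (x + s *: a) h db h0.
exists s, t; split=> //.
have -> : 'D_b ('D_a f) (x + s *: a + t *: b) * h ^+ 2 = g (x + h *: a) - g x.
  rewrite es (_ : 'D_a g _ = 'D_a f (x + s *: a + h *: b) - 'D_a f (x + s *: a)).
    by rewrite et expr2 mulrA.
  by have [_ ->] := dg (x + s *: a).
rewrite /g; ring.
Qed.

Lemma rpartialC f i j : rsmooth f ->
  rpartial i (rpartial j f) = rpartial j (rpartial i f).
Proof.
move=> sf; apply/funext => x.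
have ci : continuous (rpartial i (rpartial j f)).
  exact: rsmooth_continuous (rsmooth_partial _ (rsmooth_partial _ sf)).
have cj : continuous (rpartial j (rpartial i f)).
  exact: rsmooth_continuous (rsmooth_partial _ (rsmooth_partial _ sf)).
apply/eqP; rewrite -subr_eq0 -normr_le0; apply/ler_addgt0Pr => e e0; rewrite add0r.
have e20 : 0 < e / 2 by rewrite divr_gt0.
have /cvgrPdist_le/(_ _ e20)/nbhs_ballP[r1 /= r10 H1] := ci x.
have /cvgrPdist_le/(_ _ e20)/nbhs_ballP[r2 /= r20 H2] := cj x.
pose a : 'rV[R]_d := delta_mx ord0 i; pose b : 'rV[R]_d := delta_mx ord0 j.
pose K := `|a| + `|b| + 1.
have K0 : 0 < K by rewrite ltr_wpDl// addr_ge0.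
pose h := Num.min r1 r2 / 2 / K.
have m0 : 0 < Num.min r1 r2 by rewrite lt_min r10.
have h0 : 0 < h by rewrite !divr_gt0.
have close s t : 0 <= s <= h -> 0 <= t <= h ->
    `|x - (x + s *: a + t *: b)| < Num.min r1 r2.
  move=> /andP[s0 sh] /andP[t0 th].
  rewrite -addrA opprD addNKr normrN.
  apply: (le_lt_trans (ler_normD _ _)); rewrite !normrZ !ger0_norm//.
  apply: (@le_lt_trans _ _ (h * K)).
    rewrite /K !mulrDr mulr1; apply: (@le_trans _ _ (h * `|a| + h * `|b|)).
      by apply: lerD; apply: ler_wpM2r.
    by rewrite lerDl ltW.
  by rewrite /h divfK ?gt_eqF// ltr_pdivrMr// ltr_pMr// ltr1n.
have di := rsmooth_derivable sf.
have dj k := rsmooth_derivable (rsmooth_partial k sf).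
have [s [t [sh th E1]]] := @second_diff f b a x h (di j) (dj j i) h0.
have [s' [t' [sh' th' E2]]] := @second_diff f a b x h (di i) (dj i j) h0.
have E : 'D_a ('D_b f) (x + s *: b + t *: a) = 'D_b ('D_a f) (x + s' *: a + t' *: b).
  have hn : h ^+ 2 != 0 by rewrite expf_neq0// gt_eqF.
  apply: (mulIf hn); apply: (etrans (esym E1)); apply: (etrans _ E2).
  have -> : x + h *: b + h *: a = x + h *: a + h *: b by exact: addrAC.
  by congr (_ + _); exact: addrAC.
have B1 : `|rpartial i (rpartial j f) x - 'D_a ('D_b f) (x + s *: b + t *: a)| <= e / 2.
  apply: H1; rewrite -ball_normE /ball_ /= [x + _ + _]addrAC.
  by apply: (lt_le_trans (close _ _ th sh)); rewrite ge_min lexx.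
have B2 : `|rpartial j (rpartial i f) x - 'D_b ('D_a f) (x + s' *: a + t' *: b)| <= e / 2.
  apply: H2; rewrite -ball_normE /ball_ /=.
  by apply: (lt_le_trans (close _ _ sh' th')); rewrite ge_min lexx orbT.
rewrite -E in B2.
rewrite (splitr e); apply: (le_trans (ler_distD ('D_a ('D_b f) (x + s *: b + t *: a)) _ _)).
apply: lerD; first exact: B1.
by rewrite distrC; exact: B2.
Qed.

End RealSmooth.

(* Rcomplex R is R[i] normed by |a + ib| = sqrt (a^2 + b^2) in R; the calculus of
   complex-valued functions is that of their real and imaginary parts. *)
Section ComplexSmooth.
Variables (R : realType) (d : nat).
Implicit Types (f g : 'rV[R]_d -> Rcomplex R) (i : 'I_d) (a b : 'I_d -> nat).

Definition reP f : 'rV[R]_d -> R := fun x => complex.Re (f x).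
Definition imP f : 'rV[R]_d -> R := fun x => complex.Im (f x).

Definition smooth f : Prop := rsmooth (reP f) /\ rsmooth (imP f).

Definition partial i f : 'rV[R]_d -> Rcomplex R :=
  fun x => (rpartial i (reP f) x +i* rpartial i (imP f) x)%C.

(* \partial_0^(a 0) ... \partial_(d-1)^(a (d-1)) f; on smooth functions the order
   of the factors is irrelevant (partialC). *)
Definition pderiv_seq (s : seq 'I_d) a f := foldr (fun i g => iter (a i) (partial i) g) f s.

Definition pderiv a f := pderiv_seq (enum 'I_d) a f.

Lemma smooth_cst c : smooth (fun=> c).
Proof. by split; exact: rsmooth_cst. Qed.

Lemma smoothB f g : smooth f -> smooth g -> smooth (f - g).
Proof.
move=> [f1 f2] [g1 g2]; split.
- have -> : reP (f - g) = reP f - reP g by apply/funext => x; rewrite /reP /= !fctE raddfB.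
  exact: rsmoothB.
- have -> : imP (f - g) = imP f - imP g by apply/funext => x; rewrite /imP /= !fctE raddfB.
  exact: rsmoothB.
Qed.

Lemma reP_partial f i : reP (partial i f) = rpartial i (reP f).
Proof. by []. Qed.

Lemma imP_partial f i : imP (partial i f) = rpartial i (imP f).
Proof. by []. Qed.

Lemma smooth_partial f i : smooth f -> smooth (partial i f).
Proof. by case=> f1 f2; split; exact: rsmooth_partial. Qed.

Lemma partialB f g i : smooth f -> smooth g ->
  partial i (f - g) = partial i f - partial i g.
Proof.
move=> [f1 f2] [g1 g2]; apply/funext => x; rewrite /partial.
have -> : reP (f - g) = reP f - reP g by apply/funext => y; rewrite /reP /= !fctE raddfB.
have -> : imP (f - g) = imP f - imP g by apply/funext => y; rewrite /imP /= !fctE raddfB.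
by rewrite !rpartialB.
Qed.

Lemma partial0 i : partial i 0 = 0.
Proof.
apply/funext => x; rewrite /partial.
by rewrite (rpartial_cst (0 : R)).
Qed.

Lemma partialC f i j : smooth f -> partial i (partial j f) = partial j (partial i f).
Proof.
move=> [f1 f2]; apply/funext => x; rewrite {1 3}/partial !reP_partial !imP_partial.
by rewrite (rpartialC i j f1) (rpartialC i j f2).
Qed.

Lemma smooth_iter n f i : smooth f -> smooth (iter n (partial i) f).
Proof. by move=> sf; elim: n => //= n; exact: smooth_partial. Qed.

Lemma smooth_pderiv_seq s a f : smooth f -> smooth (pderiv_seq s a f).
Proof. by move=> sf; elim: s => //= i s; exact: smooth_iter. Qed.

Lemma smooth_pderiv a f : smooth f -> smooth (pderiv a f).
Proof. exact: smooth_pderiv_seq. Qed.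

Lemma iter_partialC m n i j f : smooth f ->
  iter m (partial i) (iter n (partial j) f) = iter n (partial j) (iter m (partial i) f).
Proof.
move=> sf; elim: m => //= m ->.
elim: n => //= n <-; apply: partialC.
by do 2 apply: smooth_iter.
Qed.

Lemma pderiv_seq_iter s a n i f : smooth f ->
  pderiv_seq s a (iter n (partial i) f) = iter n (partial i) (pderiv_seq s a f).
Proof.
by move=> sf; elim: s => //= j s ->; apply: iter_partialC; exact: smooth_pderiv_seq.
Qed.

Lemma pderiv_comp a b f : smooth f ->
  pderiv a (pderiv b f) = pderiv (fun i => (a i + b i)%N) f.
Proof.
move=> sf; rewrite /pderiv; elim: (enum _) => //= i s IH.
by rewrite pderiv_seq_iter ?IH ?iterD//; exact: smooth_pderiv_seq.
Qed.

Lemma iter_partialB n i f g : smooth f -> smooth g ->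
  iter n (partial i) (f - g) = iter n (partial i) f - iter n (partial i) g.
Proof.
by move=> sf sg; elim: n => //= n ->; apply: partialB; exact: smooth_iter.
Qed.

Lemma pderivB a f g : smooth f -> smooth g -> pderiv a (f - g) = pderiv a f - pderiv a g.
Proof.
move=> sf sg; rewrite /pderiv; elim: (enum _) => //= i s ->.
by apply: iter_partialB; exact: smooth_pderiv_seq.
Qed.

Lemma pderiv0 a : pderiv a (0 : 'rV[R]_d -> Rcomplex R) = 0.
Proof.
rewrite /pderiv; elim: (enum _) => //= i s ->.
by elim: (a i) => //= n ->; exact: partial0.
Qed.

Lemma pderiv_id f : pderiv (fun=> 0%N) f = f.
Proof. by rewrite /pderiv; elim: (enum _). Qed.

End ComplexSmooth.

Section GeneralizedFunctions.
Variables (R : realType) (d : nat) (A : set (Rtilde R d)).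

Local Notation C := (Rcomplex R).
Local Notation fnet := (eps R -> 'rV[R]_d -> C).

Definition at_net (u : fnet) (x : eps R -> euclid R d) : eps R -> C :=
  fun e => u e (x e).

(* \mathcal E_M(A): the nets x below are exactly the representatives of the
   elements of A. *)
Definition EM : {pred fnet} := fun u => `[< (forall e, smooth (u e)) /\
  forall (a : 'I_d -> nat) (x : mnet (euclid R d)), A (\pi_(Rtilde R d) x) ->
    at_net (fun e => pderiv a (u e)) (val x) \in moderate C >].

Lemma EM_zmod : zmod_closed EM.
Proof.
split.
  apply/asboolP; split=> [e|a x _]; first exact: smooth_cst.
  have -> : at_net (fun e => pderiv a ((0 : fnet) e)) (val x) = 0.
    by apply/funext => e; rewrite /at_net pderiv0.
  exact: rpred0.
move=> u v /asboolP[su hu] /asboolP[sv hv]; apply/asboolP.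
split=> [e|a x Ax]; first exact: smoothB.
have -> : at_net (fun e => pderiv a ((u - v) e)) (val x) =
  at_net (fun e => pderiv a (u e)) (val x) - at_net (fun e => pderiv a (v e)) (val x).
  by apply/funext => e; rewrite /at_net pderivB.
by apply: rpredB; [exact: hu|exact: hv].
Qed.

HB.instance Definition _ := GRing.isZmodClosed.Build fnet EM EM_zmod.

Definition mfnet := {u : fnet | u \in EM}.
HB.instance Definition _ := Choice.on mfnet.
HB.instance Definition _ := SubChoice.on mfnet.
HB.instance Definition _ := [SubChoice_isSubZmodule of mfnet by <:].

Lemma mfnet_smooth (u : mfnet) e : smooth (val u e).
Proof. by have /asboolP[] := valP u. Qed.

Lemma mfnet_moderate (u : mfnet) a (x : mnet (euclid R d)) :
  A (\pi_(Rtilde R d) x) ->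
  at_net (fun e => pderiv a (val u e)) (val x) \in moderate C.
Proof. by have /asboolP[_] := valP u; exact. Qed.

(* \mathcal N(A), as a subset of \mathcal E_M(A). *)
Definition NN : {pred mfnet} := fun u => `[<
  forall (a : 'I_d -> nat) (x : mnet (euclid R d)), A (\pi_(Rtilde R d) x) ->
    negligible_net (at_net (fun e => pderiv a (val u e)) (val x)) >].

Lemma NN_zmod : zmod_closed NN.
Proof.
have key (u : mfnet) : u \in NN <-> forall a (x : mnet (euclid R d))
    (Ax : A (\pi_(Rtilde R d) x)),
    Mnet (mfnet_moderate u a Ax) \in null_net C.
  split=> [/asboolP h a x Ax|h]; first by apply/null_netP; exact: h.
  by apply/asboolP => a x Ax; have /null_netP := h a x Ax.
split.
  apply/key => a x Ax.
  rewrite (_ : Mnet _ = 0) ?rpred0//; apply: val_inj => /=.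
  by apply/funext => e; rewrite /at_net pderiv0.
move=> u v /key hu /key hv; apply/key => a x Ax.
rewrite (_ : Mnet _ = Mnet (mfnet_moderate u a Ax) -
  Mnet (mfnet_moderate v a Ax)); first exact: rpredB.
apply: val_inj => /=; apply/funext => e.
by rewrite /at_net pderivB//; exact: mfnet_smooth.
Qed.

HB.instance Definition _ := GRing.isZmodClosed.Build mfnet NN NN_zmod.

(* \tilde{\mathcal G}(A) *)
Definition gfun := Quotient.quot NN.
HB.instance Definition _ := GRing.Zmodule.on gfun.
HB.instance Definition _ := EqQuotient.on gfun.

Lemma gfunP (u v : mfnet) : \pi_gfun u = \pi_gfun v <-> (u - v) \in NN.
Proof. by rewrite Quotient.idealrBE; split=> [->|/eqP]. Qed.

Lemma pderiv_EM (a : 'I_d -> nat) (u : mfnet) : (fun e => pderiv a (val u e)) \in EM.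
Proof.
apply/asboolP; split=> [e|b x Ax]; first exact/smooth_pderiv/mfnet_smooth.
have -> : at_net (fun e => pderiv b (pderiv a (val u e))) (val x) =
          at_net (fun e => pderiv (fun i => (b i + a i)%N) (val u e)) (val x).
  by apply/funext => e; rewrite /at_net pderiv_comp//; exact: mfnet_smooth.
exact: mfnet_moderate.
Qed.

Definition mfnet_deriv (a : 'I_d -> nat) (u : mfnet) : mfnet :=
  exist (fun v => v \in EM) _ (pderiv_EM a u).

(* \partial^a [u] = [\partial^a u]: see gderiv_pi. *)
Definition gderiv (a : 'I_d -> nat) (u : gfun) : gfun := \pi_gfun (mfnet_deriv a (repr u)).

Lemma gderiv_pi a u : gderiv a (\pi_gfun u) = \pi_gfun (mfnet_deriv a u).
Proof.
have /gfunP/asboolP h : \pi_gfun (repr (\pi_gfun u)) = \pi_gfun u by rewrite reprK.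
set w := repr _ in h; rewrite /gderiv -/w.
apply/gfunP/asboolP => b x Ax.
have := h (fun i => (b i + a i)%N) x Ax.
congr negligible_net; apply/funext => e; rewrite /at_net /=.
have sw := mfnet_smooth w e; have su := mfnet_smooth u e.
rewrite [LHS](_ : _ = (pderiv (fun i => (b i + a i)%N) (val w e) -
   pderiv (fun i => (b i + a i)%N) (val u e)) (val x e)); last by rewrite -pderivB.
rewrite [RHS](_ : _ = (pderiv b (pderiv a (val w e)) -
   pderiv b (pderiv a (val u e))) (val x e)); last first.
  by rewrite -pderivB//; exact: smooth_pderiv.
by rewrite !pderiv_comp.
Qed.

Lemma at_net_moderate (u : mfnet) (x : mnet (euclid R d)) :
  A (\pi_(Rtilde R d) x) -> at_net (val u) (val x) \in moderate C.
Proof.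
move=> Ax.
have -> : at_net (val u) (val x) = at_net (fun e => pderiv (fun=> 0%N) (val u e)) (val x).
  by apply/funext => e; rewrite /at_net pderiv_id.
exact: mfnet_moderate.
Qed.

Lemma repr_mem (x : A) : A (\pi_(Rtilde R d) (repr (val x))).
Proof. by rewrite reprK; exact: set_valP. Qed.

(* The point value u(x), computed on the representatives chosen by repr; independence
   of that choice is not part of the definition. *)
Definition gval (u : gfun) (x : A) : Ctilde R :=
  \pi_(Ctilde R) (Mnet (at_net_moderate (repr u) (repr_mem x))).

End GeneralizedFunctions.

(* Main.v *)
(* Points on the segment between two representatives of a generalized point represent
   that point as well, so the mean value theorem and the moderateness of the first
   derivatives give (1).  For (2), Landau's inequality bounds |D_i u(y)| by
   (|u(y + h e_i)| + |u(y)|) / h + h sup |D_i^2 u|; taking h = eps ^ k with k large makes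
   both terms small, since y + h e_i stays in the sharp ball where u vanishes.  Hence
   D_i u vanishes on the same ball, and one iterates.  (3) applies (2) at every point. *)

Require Import Defs.
From mathcomp Require Import all_boot all_order all_algebra.
From mathcomp Require Import generic_quotient ring_quotient complex.
From mathcomp Require Import ring lra.
From mathcomp Require Import all_classical all_reals all_analysis.

Set Implicit Arguments.
Unset Strict Implicit.
Unset Printing Implicit Defensive.

Import Order.TTheory GRing.Theory Num.Theory.
Import numFieldNormedType.Exports.

Local Open Scope classical_set_scope.
Local Open Scope ring_scope.
Local Open Scope quotient_scope.

(** * Comparison of norms in C and R^d with real parts, imaginary parts and coordinates *)

Section ComplexNorm.
Variable R : realType.
Implicit Types z : Rcomplex R.

Lemma Rcomplex_normE z : `|z| = Num.sqrt (complex.Re z ^+ 2 + complex.Im z ^+ 2).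
Proof. by case: z. Qed.

Lemma Re_le_norm z : `|complex.Re z| <= `|z|.
Proof. by rewrite Rcomplex_normE -sqrtr_sqr ler_wsqrtr// lerDl sqr_ge0. Qed.

Lemma Im_le_norm z : `|complex.Im z| <= `|z|.
Proof. by rewrite Rcomplex_normE -sqrtr_sqr ler_wsqrtr// lerDr sqr_ge0. Qed.

Lemma norm_le_ReIm z : `|z| <= `|complex.Re z| + `|complex.Im z|.
Proof.
rewrite Rcomplex_normE -[leRHS]ger0_norm ?addr_ge0// -sqrtr_sqr ler_wsqrtr//.
rewrite sqrrD !real_normK ?num_real// lerD2r lerDl mulrn_wge0// mulr_ge0//.
Qed.

End ComplexNorm.

Section EuclidNorm.
Variables (R : realType) (d : nat).
Implicit Types (x : euclid R d) (i : 'I_d).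

Lemma coord_le_enorm x i : `|x ord0 i| <= `|x|.
Proof.
rewrite -sqrtr_sqr; apply: ler_wsqrtr; rewrite (bigD1 i)//= lerDl.
by apply: sumr_ge0 => j _; exact: sqr_ge0.
Qed.

Lemma enorm_axis (h : R) i : `|h *: delta_mx ord0 i : euclid R d| = `|h|.
Proof.
rewrite -[RHS]sqrtr_sqr; congr Num.sqrt; rewrite (bigD1 i)//= big1 => [|j ji].
  by rewrite !mxE !eqxx mulr1 addr0.
by rewrite !mxE (negbTE ji) andbF mulr0 expr0n.
Qed.

End EuclidNorm.

(** * Mean value, Landau and maximum estimates along a coordinate axis *)

Section Increments.
Variables (R : realType) (d : nat) (i : 'I_d).
Local Notation ei := (delta_mx ord0 i : 'rV[R]_d).

Lemma rsmooth_increment (f : 'rV[R]_d -> R) x (h : R) : rsmooth f ->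
  exists2 c : R, `|c| <= `|h| &
    f (x + h *: ei) - f x = rpartial i f (x + c *: ei) * h.
Proof.
move=> /rsmooth_derivable/(_ i) df.
have [h0|h0|->] := ltgtP h 0; last first.
- by exists 0; rewrite // scale0r addr0 subrr mulr0.
- have [c /andP[c0 ch] E] := mvt_line x df h0.
  by exists c; rewrite // !ger0_norm// ltW.
- have nh0 : 0 < - h by rewrite oppr_gt0.
  have [c /andP[c0 ch] E] := mvt_line (x + h *: ei) df nh0.
  (* For negative [h] the mean value theorem starts at [x + h *: ei] and goes forward by [- h], so
     the offset from [x] is [h + c]. *)
  exists (h + c).
    by rewrite (ltr0_norm h0) ler_norml; apply/andP; split; lra.
  move: E; rewrite scaleNr addrK => E.
  by rewrite scalerDl addrA -[LHS]opprB E mulrN opprK.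
Qed.

(** The mean value theorem fails for complex values; it is applied to the real and imaginary parts
    separately, hence two intermediate points. *)
Lemma smooth_increment (f : 'rV[R]_d -> Rcomplex R) x (h : R) : smooth f ->
  exists c : R * R, [/\ `|c.1| <= `|h|, `|c.2| <= `|h| &
    `|f (x + h *: ei) - f x| <=
      `|h| * (`|partial i f (x + c.1 *: ei)| + `|partial i f (x + c.2 *: ei)|)].
Proof.
move=> [sr si].
have [c1 hc1 E1] := rsmooth_increment x h sr.
have [c2 hc2 E2] := rsmooth_increment x h si.
exists (c1, c2); split => //=; apply: (le_trans (norm_le_ReIm _)).
rewrite (_ : complex.Re _ = reP f (x + h *: ei) - reP f x); last exact: raddfB.
rewrite (_ : complex.Im _ = imP f (x + h *: ei) - imP f x); last exact: raddfB.
rewrite E1 E2 !normrM -!(mulrC `|h|) -mulrDr ler_wpM2l//.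
apply: lerD; first exact: (Re_le_norm (partial i f (x + c1 *: ei))).
exact: (Im_le_norm (partial i f (x + c2 *: ei))).
Qed.

(** The difference quotient equals the derivative at some [x + c *: ei]; a second mean value step
    brings it back to [x] at a cost of at most [h * M]. *)
Lemma rsmooth_landau (f : 'rV[R]_d -> R) x (h M : R) : rsmooth f -> 0 < h ->
  (forall s, 0 <= s <= h -> `|rpartial i (rpartial i f) (x + s *: ei)| <= M) ->
  `|rpartial i f x| <= (`|f (x + h *: ei)| + `|f x|) / h + h * M.
Proof.
move=> sf h0 HM.
have [c /andP[c0 ch] E] := mvt_line x (@rsmooth_derivable _ _ _ sf i) h0.
have M0 : 0 <= M by apply: le_trans (HM 0 _); rewrite ?lexx ?(ltW h0).
have B1 : `|rpartial i f (x + c *: ei)| <= (`|f (x + h *: ei)| + `|f x|) / h.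
  rewrite ler_pdivlMr// -[X in _ * X](gtr0_norm h0) -normrM -E.
  exact: ler_normB.
have B2 : `|rpartial i f (x + c *: ei) - rpartial i f x| <= h * M.
  (* [mvt_line] needs a positive length, so [c = 0] is treated apart. *)
  move: c0; rewrite le_eqVlt => /predU1P[<-|c0].
    by rewrite scale0r addr0 subrr normr0 mulr_ge0// ltW.
  have [s /andP[s0 sc] ->] := mvt_line x (@rsmooth_derivable _ _ _ (rsmooth_partial i sf) i) c0.
  rewrite normrM mulrC (gtr0_norm c0); apply: ler_pM; rewrite ?(ltW c0)//.
  by apply: HM; rewrite s0 (le_trans sc ch).
rewrite -[X in `|X|](subKr (rpartial i f (x + c *: ei))).
by apply: (le_trans (ler_normB _ _)); apply: lerD.
Qed.

Lemma smooth_landau (f : 'rV[R]_d -> Rcomplex R) x (h M : R) : smooth f -> 0 < h ->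
  (forall s, 0 <= s <= h -> `|partial i (partial i f) (x + s *: ei)| <= M) ->
  `|partial i f x| <= 2 * ((`|f (x + h *: ei)| + `|f x|) / h + h * M).
Proof.
move=> [sr si] h0 HM; apply: (le_trans (norm_le_ReIm _)).
have mono a b : a <= `|f (x + h *: ei)| -> b <= `|f x| ->
    (a + b) / h + h * M <= (`|f (x + h *: ei)| + `|f x|) / h + h * M.
  by move=> ha hb; rewrite lerD2r ler_wpM2r ?lerD// invr_ge0 ltW.
rewrite mulr_natl mulr2n; apply: lerD.
- apply: (@le_trans _ _ ((`|reP f (x + h *: ei)| + `|reP f x|) / h + h * M)).
    apply: rsmooth_landau => // s /HM; apply: le_trans.
    exact: (Re_le_norm (partial i (partial i f) _)).
  by apply: mono; exact: Re_le_norm.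
- apply: (@le_trans _ _ ((`|imP f (x + h *: ei)| + `|imP f x|) / h + h * M)).
    apply: rsmooth_landau => // s /HM; apply: le_trans.
    exact: (Im_le_norm (partial i (partial i f) _)).
  by apply: mono; exact: Im_le_norm.
Qed.

Lemma rsmooth_line_continuous (f : 'rV[R]_d -> R) x : rsmooth f ->
  continuous (fun s : R => f (x + s *: ei)).
Proof.
move=> /rsmooth_derivable/(_ i) df t; apply: differentiable_continuous.
by apply/derivable1_diffP; have [] := derive_line (df (x + t *: ei)).
Qed.

(** The function maximized is |Re f| + |Im f|, which lies between |f| and 2|f|; this is the source
    of the factor 2. Controlling the whole segment by one point lets moderateness along a single net
    bound it. *)
Lemma smooth_segment_max (f : 'rV[R]_d -> Rcomplex R) x (h : R) : smooth f -> 0 <= h ->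
  exists2 c : R, 0 <= c <= h &
    forall s, 0 <= s <= h -> `|f (x + s *: ei)| <= 2 * `|f (x + c *: ei)|.
Proof.
move=> [sr si] h0.
pose g (s : R) : R := `|reP f (x + s *: ei)| + `|imP f (x + s *: ei)|.
have cg : continuous g.
  by move=> s; apply: cvgD; apply: cvg_norm; exact: rsmooth_line_continuous.
have [c] := EVT_max h0 (continuous_subspaceT cg).
rewrite in_itv/= => ch Hc; exists c => // s sh.
apply: (le_trans (norm_le_ReIm _)); apply: (@le_trans _ _ (g c)).
  by apply: Hc; rewrite in_itv.
rewrite mulr_natl mulr2n; apply: lerD; first exact: Re_le_norm.
exact: Im_le_norm.
Qed.

End Increments.

(** * Calculus of negligible nets and small displacements in the sharp metric *)

Section Negligible.
Variables (R : realType) (E : normedZmodType R).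
Implicit Types x y : eps R -> E.

Lemma negligibleD x y : negligible_net x -> negligible_net y -> negligible_net (x + y).
Proof.
move=> /vnet_eqy hx /vnet_eqy hy; apply/vnet_eqy/eqP; rewrite -leye_eq.
by have := vnetD x y; rewrite hx hy minxx.
Qed.

Lemma negligible_le (F : normedZmodType R) x (z : eps R -> F) :
  (forall e, `|x e| <= `|z e|) -> negligible_net z -> negligible_net x.
Proof. by move=> le_xz hz m; apply: for_smallS (hz m) => e; apply: le_trans. Qed.

Lemma bounded_moderate x : for_small (fun e => `|x e| <= 1) -> x \in moderate E.
Proof.
by move=> hx; apply/moderateP; exists 0%N; apply: for_smallS hx => e; rewrite expr0 invr1.
Qed.

Lemma negligible_moderate x : negligible_net x -> x \in moderate E.
Proof. by move=> /(_ 0%N) hx; apply: bounded_moderate. Qed.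

Lemma negligible_mul_moderate (h : eps R -> R) (v w : eps R -> E) (z : eps R -> E) :
  negligible_net h -> v \in moderate E -> w \in moderate E ->
  (forall e, `|z e| <= `|h e| * (`|v e| + `|w e|)) -> negligible_net z.
Proof.
move=> hh /moderateP[N1 hv] /moderateP[N2 hw] hz m.
have half : for_small (fun e : eps R => val e <= 2^-1).
  by apply: for_small_le; rewrite invr_gt0.
(* The exponent has [maxn N1 N2] to cancel the moderate growth, and one more power of eps, at most
   1/2, to absorb the factor 2 from the sum. *)
apply: for_smallS2 (filterI hv hw) (filterI (hh (maxn N1 N2 + m).+1) half).
move=> e [ve we] [he e2]; have e0 := eps_gt0 e.
apply: (le_trans (hz e)).
apply: (@le_trans _ _ (val e ^+ (maxn N1 N2 + m).+1 * (2 * val e ^- maxn N1 N2))).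
  apply: ler_pM => //.
  rewrite mulr_natl mulr2n; apply: lerD.
    by apply: (le_trans ve); apply: expV_mono; exact: leq_maxl.
  by apply: (le_trans we); apply: expV_mono; exact: leq_maxr.
rewrite exprS exprD.
have en : val e ^+ maxn N1 N2 != 0 by rewrite expf_neq0// gt_eqF.
rewrite (_ : _ * _ = (2 * val e) * val e ^+ m); last by field.
rewrite ler_piMl ?exprn_ge0 ?(ltW e0)//.
by move: e2; lra.
Qed.

Lemma sharp_norm_le (x : mnet E) (k : nat) :
  for_small (fun e => `|val x e| <= val e ^+ k) ->
  sharp_norm (\pi_(gpt E) x) <= expR (- k%:R).
Proof.
move=> hx; rewrite -lee_fin sharp_normE sharp_val_pi.
rewrite -[(expR _)%:E]/(expeR (- (k%:R)%:E)) lee_expeR leeN2.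
apply: vnet_ge; apply: for_smallS hx => e.
by rewrite powR_mulrn ?(ltW (eps_gt0 _)).
Qed.

Lemma sharp_dist_shift (x p : mnet E) (k : nat) :
  for_small (fun e => `|val p e| <= val e ^+ k) ->
  sharp_dist (\pi_(gpt E) x) (\pi_(gpt E) (x + p)) <= expR (- k%:R).
Proof.
move=> hp; rewrite /sharp_dist raddfD opprD addNKr sharp_normN.
exact: sharp_norm_le.
Qed.

Lemma pi_shift (x p : mnet E) : negligible_net (val p) ->
  \pi_(gpt E) (x + p) = \pi_(gpt E) x.
Proof. by move=> hp; apply/gptP; apply: negligible_le hp => e /=; rewrite addrC addKr. Qed.

End Negligible.

(** * Displacements along an axis, and first partials as multi-index derivatives *)

Section AxisNets.
Variables (R : realType) (d : nat).

Definition axis_net (i : 'I_d) (h : eps R -> R) : eps R -> euclid R d :=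
  fun e => h e *: delta_mx ord0 i.

Lemma axis_net_negligible i h : negligible_net h -> negligible_net (axis_net i h).
Proof. by apply: negligible_le => e; rewrite enorm_axis. Qed.

Lemma axis_net_small i h (k : nat) : (forall e, `|h e| <= val e ^+ k) ->
  for_small (fun e => `|axis_net i h e| <= val e ^+ k).
Proof. by move=> hk; apply: filterE => e; rewrite enorm_axis. Qed.

Lemma axis_net_moderate i h (k : nat) : (forall e, `|h e| <= val e ^+ k) ->
  axis_net i h \in moderate (euclid R d).
Proof.
move=> hk; apply: bounded_moderate; apply: for_smallS (axis_net_small i hk) => e.
move=> /le_trans; apply; apply: exprn_ile1; first exact/ltW/eps_gt0.
exact/ltW/eps_lt1.
Qed.

(** The enumeration of the coordinates contains [i] exactly once. This gives access to first
    partials through the multi-indices of [EM]. *)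
Lemma pderiv_delta i (f : 'rV[R]_d -> Rcomplex R) :
  pderiv (fun j => (j == i) : nat) f = partial i f.
Proof.
have E s : pderiv_seq s (fun j => (j == i) : nat) f = iter (count_mem i s) (partial i) f.
  by elim: s => //= j s ->; case: eqP => [->|].
by rewrite /pderiv E count_uniq_mem ?enum_uniq// mem_enum.
Qed.

End AxisNets.

(** * Independence of point values from the representatives *)

Section PointValues.
Variables (R : realType) (d : nat) (A : set (Rtilde R d)).
Implicit Types (u v : mfnet A) (x y : mnet (euclid R d)).

Lemma mfnet_partial_moderate u (i : 'I_d) x : A (\pi_(Rtilde R d) x) ->
  at_net (fun e => partial i (val u e)) (val x) \in moderate (Rcomplex R).
Proof.
move=> Ax; rewrite (_ : at_net _ _ =
  at_net (fun e => pderiv (fun j => (j == i) : nat) (val u e)) (val x)).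
  exact: mfnet_moderate.
by apply/funext => e; rewrite /at_net pderiv_delta.
Qed.

(** The intermediate points are within [|h|] of [x], so they represent the same element of [A]. The
    first partials are therefore moderate there, and multiplying by [h] makes them negligible. *)
Lemma at_net_axis_shift u x (i : 'I_d) (h : eps R -> R) :
  A (\pi_(Rtilde R d) x) -> negligible_net h ->
  negligible_net (at_net (val u) (val x + axis_net i h) - at_net (val u) (val x)).
Proof.
move=> Ax hh.
have /choice[c hc] e := smooth_increment i (val x e) (h e) (mfnet_smooth u e).
have n1 : negligible_net (fun e => (c e).1).
  by apply: negligible_le hh => e; have [] := hc e.
have n2 : negligible_net (fun e => (c e).2).
  by apply: negligible_le hh => e; have [] := hc e.
have a1 := axis_net_negligible i n1; have a2 := axis_net_negligible i n2.
have m p (np : negligible_net p) := @mfnet_partial_moderate u i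
  (x + Mnet (negligible_moderate np)).
apply: (negligible_mul_moderate hh (m _ a1 _) (m _ a2 _)); rewrite ?pi_shift//.
by move=> e; have [_ _] := hc e; exact.
Qed.

(* Changing one coordinate at a time reduces the claim to [at_net_axis_shift]: all
   intermediate nets represent the same point. *)
Lemma at_net_shift u x y : A (\pi_(Rtilde R d) x) ->
  \pi_(Rtilde R d) x = \pi_(Rtilde R d) y ->
  negligible_net (at_net (val u) (val y) - at_net (val u) (val x)).
Proof.
move=> Ax /esym/gptP hp; pose p e : 'rV[R]_d := val y e - val x e.
(* The base net [z] stays general, since the induction restarts from the shifted net [z']. *)
have key (s : seq 'I_d) z : A (\pi_(Rtilde R d) z) -> negligible_net
    (at_net (val u) (fun e => val z e + \sum_(j <- s) p e ord0 j *: delta_mx ord0 j)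
     - at_net (val u) (val z)).
  elim: s z => [|j s IH] z Az.
    rewrite (_ : _ - _ = 0).
      by move=> m; apply: filterE => e; rewrite normr0 exprn_ge0// ltW ?eps_gt0.
    by apply/funext => e; rewrite !fctE /at_net big_nil addr0 subrr.
  have nj : negligible_net (fun e => p e ord0 j).
    by apply: negligible_le hp => e; exact: (coord_le_enorm (p e)).
  have aj := axis_net_negligible j nj.
  pose z' : mnet (euclid R d) := z + Mnet (negligible_moderate aj).
  have Az' : A (\pi_(Rtilde R d) z') by rewrite pi_shift.
  have := negligibleD (IH z' Az') (at_net_axis_shift u j Az nj).
  congr negligible_net; apply/funext => e; rewrite !fctE /at_net /= big_cons.
  rewrite subrKA; congr (_ - _); congr (val u e _).
  exact/esym/(addrA (val z e)).
have := key (enum 'I_d) x Ax; congr negligible_net; apply/funext => e.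
rewrite !fctE /at_net; congr (val u e _ - _).
by rewrite big_enum -[X in _ + X](row_sum_delta (p e)) addrC subrK.
Qed.

(** The representative of [u] is changed first, at the fixed net [repr (val x)], by the order-zero
    condition in [NN]; then [at_net_shift] changes the net of the point. *)
Lemma gval_pi (u : gfun A) (x : A) u_ x_ :
  \pi_(gfun A) u_ = u -> \pi_(Rtilde R d) x_ = val x ->
  exists2 c_ : mnet (Rcomplex R),
    forall e, val c_ e = val u_ e (val x_ e) & gval u x = \pi_(Ctilde R) c_.
Proof.
move=> Eu Ex.
have Ax : A (\pi_(Rtilde R d) x_) by rewrite Ex; exact: set_valP.
exists (Mnet (at_net_moderate u_ Ax)) => //; apply/gptP.
have Er : \pi_(Rtilde R d) x_ = \pi_(Rtilde R d) (repr (val x)) by rewrite reprK.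
have /gfunP/asboolP hu : \pi_(gfun A) (repr u) = \pi_(gfun A) u_ by rewrite reprK.
have := hu (fun=> 0%N) _ (repr_mem x).
rewrite (_ : at_net _ _ = at_net (val (repr u)) (val (repr (val x))) -
   at_net (val u_) (val (repr (val x)))); last first.
  by apply/funext => e; rewrite /at_net pderiv_id.
move=> /negligibleD/(_ (at_net_shift u_ Ax Er)).
by congr negligible_net; apply/funext => e; rewrite !fctE subrKA.
Qed.

Lemma gval_pi_eq0 (u : gfun A) (x : A) u_ x_ :
  \pi_(gfun A) u_ = u -> \pi_(Rtilde R d) x_ = val x ->
  gval u x = 0 <-> negligible_net (at_net (val u_) (val x_)).
Proof.
move=> Eu Ex; have [c hc ->] := gval_pi Eu Ex.
rewrite gpt0 gptP (_ : (fun e => _) = at_net (val u_) (val x_))//.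
by apply/funext => e; rewrite hc subr0.
Qed.

End PointValues.

(** * Vanishing on a sharp ball passes to derivatives *)

Section Flatness.
Variables (R : realType) (d : nat) (A : set (Rtilde R d)).
Variables (x0 : Rtilde R d) (r : R).
Hypothesis ballA : forall y, sharp_dist x0 y < r -> A y.
Implicit Types (u v : mfnet A) (y p : mnet (euclid R d)).

Definition null_on_ball u := forall y, sharp_dist x0 (\pi_(Rtilde R d) y) < r ->
  negligible_net (at_net (val u) (val y)).

(** By the ultrametric inequality the radius does not shrink, so differentiation can be iterated on
    one and the same ball. *)
Lemma sharp_ball_shift y p (k : nat) :
  expR (- k%:R) < r -> sharp_dist x0 (\pi_(Rtilde R d) y) < r ->
  for_small (fun e => `|val p e| <= val e ^+ k) ->
  sharp_dist x0 (\pi_(Rtilde R d) (y + p)) < r.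
Proof.
move=> kr yr /(sharp_dist_shift y) ykp; set z := \pi_(_) (y + p) in ykp *.
rewrite /sharp_dist -(subrKA (\pi_(Rtilde R d) y)).
apply: (le_lt_trans (sharp_normD_max _ _)).
by rewrite gt_max yr (le_lt_trans ykp).
Qed.

(* The step [h = eps ^ k] is fixed only after the order [N] of the second
   derivative, so [N] must not depend on [k]: it is the order at a net [y + c]
   that nearly maximizes the second derivative on a segment of length [eps ^ k0]
   containing all the segments of length [h]. *)
Lemma null_on_ball_partial u v (i : 'I_d) :
  (forall e, val v e = partial i (val u e)) -> null_on_ball u -> null_on_ball v.
Proof.
move=> vE hu y yr m.
have r0 : 0 < r by apply: le_lt_trans yr; exact: sharp_norm_ge0.
have [k0 k0r] : exists k : nat, expR (- k%:R) < r.
  exists (Num.bound r^-1); rewrite expRN -[ltRHS]invrK ltf_pV2 ?posrE ?expR_gt0 ?invr_gt0//.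
  (* With [k] the chosen bound, e^k >= 1 + k > 1/r. *)
  apply: lt_le_trans (expR_ge1Dx _); apply: (@lt_trans _ _ (Num.bound r^-1)%:R).
    by apply: archi_boundP; rewrite invr_ge0 ltW.
  by rewrite ltrDr.
have sv e : smooth (partial i (val v e)) by exact/smooth_partial/mfnet_smooth.
have pow0 (e : eps R) k : 0 <= val e ^+ k by rewrite exprn_ge0// ltW ?eps_gt0.
have /choice[c hc] (e : eps R) : exists c : R, 0 <= c <= val e ^+ k0 /\
    forall s, 0 <= s <= val e ^+ k0 ->
      `|partial i (val v e) (val y e + s *: delta_mx ord0 i)| <=
      2 * `|partial i (val v e) (val y e + c *: delta_mx ord0 i)|.
  by have [c] := smooth_segment_max i (val y e) (sv e) (pow0 e k0); exists c.
have ck e : `|c e| <= val e ^+ k0.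
  by have [/andP[c0 ce] _] := hc e; rewrite ger0_norm.
pose yc := y + Mnet (axis_net_moderate i ck).
have Ayc : A (\pi_(Rtilde R d) yc).
  by apply/ballA/(sharp_ball_shift k0r yr)/axis_net_small.
have /moderateP[N hN] := mfnet_partial_moderate v i Ayc.
(* The summand [k0] keeps the step inside the ball and the segment, [N] cancels the growth of the
   second derivative, [m] is the target order, and two spare powers of eps absorb the constants. *)
pose k := (k0 + (N + m + 2))%N.
pose h (e : eps R) := val e ^+ k.
have hk0 e : `|h e| <= val e ^+ k0.
  by rewrite (ger0_norm (pow0 e k)) /k exprD ler_piMr ?exprn_ile1 ?(ltW (eps_gt0 _)) ?(ltW (eps_lt1 _)).
pose yh := y + Mnet (axis_net_moderate i hk0).
have yhr : sharp_dist x0 (\pi_(Rtilde R d) yh) < r.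
  exact/(sharp_ball_shift k0r yr)/axis_net_small.
have quarter : for_small (fun e : eps R => val e <= 4^-1).
  by apply: for_small_le; rewrite invr_gt0.
(* Order [k + m + 2] leaves eps^(m + 2) after division by [h = eps ^ k]. *)
apply: for_smallS2 (filterI quarter hN) (filterI (hu _ yr (k + m + 2)%N) (hu _ yhr (k + m + 2)%N)).
move=> e [e4 eN] [ey eyh]; have e0 := eps_gt0 e.
have h0 : 0 < h e by rewrite exprn_gt0.
rewrite /at_net vE.
apply: (le_trans (smooth_landau (M := 2 * val e ^- N) (mfnet_smooth u e) h0 _)).
  move=> s /andP[s0 sh]; have [_ hce] := hc e.
  rewrite -vE; apply: (le_trans (hce s _)); last by rewrite ler_wpM2l.
  by rewrite s0 (le_trans sh)// (le_trans _ (hk0 e))// ler_norm.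
have en n : val e ^+ n != 0 by rewrite expf_neq0// gt_eqF.
apply: (@le_trans _ _ (2 * ((val e ^+ (k + m + 2) + val e ^+ (k + m + 2)) / h e
    + h e * (2 * val e ^- N)))).
  by rewrite ler_wpM2l// lerD2r ler_wpM2r ?invr_ge0 ?(ltW h0)// lerD.
have -> : (val e ^+ (k + m + 2) + val e ^+ (k + m + 2)) / h e = 2 * val e ^+ m * val e ^+ 2.
  by rewrite /h !exprD; field; rewrite ?en// gt_eqF.
have -> : h e * (2 * val e ^- N) = 2 * val e ^+ k0 * (val e ^+ m * val e ^+ 2).
  by rewrite /h /k !exprD; field; rewrite ?en// gt_eqF.
have ek1 : val e ^+ k0 <= 1 by rewrite exprn_ile1// ltW ?eps_lt1.
have em := pow0 e m.
(* The total is 4ab + 4qab <= 8ab in the abbreviations below, so b <= 1/8 suffices for the bound a =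
   eps^m. *)
have e2 : val e ^+ 2 <= 8^-1 by rewrite expr2; nra.
have e20 := pow0 e 2.
set a := val e ^+ m in em *; set b := val e ^+ 2 in e2 e20 *.
set q := val e ^+ k0 in ek1 *.
have ab0 : 0 <= a * b by rewrite mulr_ge0.
have qab : q * (a * b) <= a * b by rewrite ler_piMl.
have ab8 : a * b <= a * 8^-1 by rewrite ler_wpM2l.
lra.
Qed.

(** The one-step lemma is iterated in each coordinate and then over the coordinates. The witnesses
    [w] carry the [EM] membership of every intermediate derivative. *)
Lemma null_on_ball_pderiv u (a : 'I_d -> nat) :
  null_on_ball u -> null_on_ball (mfnet_deriv a u).
Proof.
have iter_case n i v : null_on_ball v -> exists2 w : mfnet A,
    (forall e, val w e = iter n (partial i) (val v e)) & null_on_ball w.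
  move=> hv; elim: n => [|n [w wE hw]]; first by exists v.
  pose w' := mfnet_deriv (fun j => (j == i) : nat) w.
  have w'E e : val w' e = partial i (val w e) by exact: pderiv_delta.
  exists w'; first by move=> e; rewrite w'E wE.
  exact: null_on_ball_partial hw.
move=> hu; suff [w wE hw] : exists2 w : mfnet A,
    (forall e, val w e = pderiv a (val u e)) & null_on_ball w.
  by rewrite (_ : mfnet_deriv a u = w)//; apply/val_inj/funext => e; rewrite wE.
rewrite /pderiv; elim: (enum _) => [|i s [w wE hw]]; first by exists u.
have [w' w'E hw'] := iter_case (a i) i w hw.
by exists w' => // e; rewrite w'E wE.
Qed.

End Flatness.

(** * From nets back to generalized functions *)

Section Vanishing.
Variables (R : realType) (d : nat) (A : set (Rtilde R d)).
Implicit Types u : gfun A.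

Lemma gval_gderiv_eq0 u (x : A) (V : set (Rtilde R d)) (a : 'I_d -> nat) :
  interior A (val x) -> nbhs (val x) V -> (forall y : A, V (val y) -> gval u y = 0) ->
  gval (gderiv a u) x = 0.
Proof.
move=> xA xV uV.
(* On a common ball, [A] ensures that point values exist and [V] that they are zero. *)
have /nbhs_ballP[r /= r0 ballAV] : nbhs (val x) (A `&` V) by exact: filterI.
have ballA y : sharp_dist (val x) y < r -> A y by move=> /ballAV[].
have u0 : null_on_ball (val x) r (repr u).
  move=> y /ballAV[Ay Vy].
  pose yA : A := SigSub (mem_set Ay).
  by apply/(gval_pi_eq0 (x := yA) (reprK u) erefl); exact: uV.
have Ea : \pi_(gfun A) (mfnet_deriv a (repr u)) = gderiv a u.
  by rewrite -gderiv_pi reprK.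
apply/(gval_pi_eq0 Ea (reprK (val x))).
apply: (null_on_ball_pderiv ballA a u0).
by rewrite reprK sharp_distxx.
Qed.

(** Membership in [NN] concerns derivatives of all orders; they vanish at each point by
    [gval_gderiv_eq0], with the whole space as neighbourhood. *)
Lemma gfun_eq0 u : open A -> (forall x : A, gval u x = 0) -> u = 0.
Proof.
move=> oA ux0; rewrite -[u]reprK -[RHS](raddf0 (\pi_(gfun A))).
apply/gfunP; rewrite subr0; apply/asboolP => a x Ax.
pose xA : A := SigSub (mem_set Ax).
have Ea : \pi_(gfun A) (mfnet_deriv a (repr u)) = gderiv a u.
  by rewrite -gderiv_pi reprK.
apply/(gval_pi_eq0 (x := xA) Ea erefl).
apply: (@gval_gderiv_eq0 _ _ setT) => //; last exact: filterT.
by rewrite /interior; exact: open_nbhs_nbhs.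
Qed.

Lemma gval0 (x : A) : gval (0 : gfun A) x = 0.
Proof.
apply/(gval_pi_eq0 (u_ := 0) (raddf0 _) (reprK (val x))) => m.
by apply: filterE => e; rewrite normr0 exprn_ge0// ltW ?eps_gt0.
Qed.

End Vanishing.

Theorem proposition3p6 (R : realType) (d : nat) (A : set (Rtilde R d))
    (hA : A !=set0) (u : gfun A) :
  [/\ forall (x : A) (u_ : mfnet A) (x_ : mnet (euclid R d)),
        \pi_(gfun A) u_ = u -> \pi_(Rtilde R d) x_ = val x ->
        exists2 c_ : mnet (Rcomplex R),
          forall e, val c_ e = val u_ e (val x_ e) &
          gval u x = \pi_(Ctilde R) c_,
      forall x : A, interior A (val x) ->
        (exists2 V : set (Rtilde R d), nbhs (val x) V &
           forall y : A, V (val y) -> gval u y = 0) ->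
        forall a : 'I_d -> nat, gval (gderiv a u) x = 0 &
      open A -> (u = 0 <-> forall x : A, gval u x = 0)].
Proof.
split.
- by move=> x u_ x_; exact: gval_pi.
- by move=> x xA [V xV uV] a; exact: gval_gderiv_eq0 xV uV.
- by move=> oA; split=> [-> x|]; [exact: gval0|exact: gfun_eq0].
Qed.
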